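(* Consider the expert problem over the simplex $\Delta_d$, $d\ge2$. For any learning rate $\eta>0$ there exists a loss sequence $\ell_1,\dots,\ell_T$ with $\ell_t\in[-4,4]^d$ for all $t\in\{1,\dots,T\}$ such that both Optimistic Online Gradient Descent (OOGD) with learning rate $\eta$ and Predictive Regret Matching$^+$ (PRM$^+$) suffer alternating regret $\mathrm{Reg}_{\mathrm{Alt}}=\Omega(\sqrt T)$ on it.
   Context: $\Delta_d=\{p\in\mathbb R^d:p_i\ge0,\ \sum_ip_i=1\}$. An algorithm plays $p_t\in\Delta_d$ in round $t$ and then observes $\ell_t\in\mathbb R^d$; $p_{T+1}$ is its output after $\ell_1,\dots,\ell_T$. Alternating regret: $\mathrm{Reg}_{\mathrm{Alt}}=\max_{u\in\Delta_d}\left\{\sum_{t=1}^T\langle p_t+p_{t+1},\ell_t\rangle-2\sum_{t=1}^T\langle u,\ell_t\rangle\right\}$. $\Omega(\sqrt T)$ means at least $c\sqrt T$ for all sufficiently large $T$, with $c>0$ a constant not depending on $T$ or $\eta$ (which may depend on $T$). OOGD with learning rate $\eta>0$: $\hat p_1=\frac1d\mathbf 1$, $m_1=\mathbf 0$; in round $t$ play $p_t=\operatorname{argmin}_{p\in\Delta_d}\{\langle p,m_t\rangle+\frac1{2\eta}\|p-\hat p_t\|_2^2\}$, and after receiving $\ell_t$ set $\hat p_{t+1}=\operatorname{argmin}_{p\in\Delta_d}\{\langle p,\ell_t\rangle+\frac1{2\eta}\|p-\hat p_t\|_2^2\}$ and $m_{t+1}=\ell_t$. PRM$^+$: $R_1=r_0=\mathbf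 0\in\mathbb R^d$; in round $t\ge1$ set $\hat R_t=[R_t+r_{t-1}]^+$ (coordinatewise positive part) and play $p_t=\hat R_t/\|\hat R_t\|_1$ (the uniform distribution $\frac1d\mathbf 1$ if $\hat R_t=\mathbf 0$); after receiving $\ell_t$ set $r_t=\langle p_t,\ell_t\rangle\mathbf 1-\ell_t$ and $R_{t+1}=[R_t+r_t]^+$. *)

(* Defs.v *)
From HB Require Import structures.
From mathcomp Require Import all_boot all_order all_algebra.
From mathcomp Require Import boolp classical_sets reals.

Set Implicit Arguments.
Unset Strict Implicit.
Unset Printing Implicit Defensive.

Import Order.TTheory GRing.Theory Num.Theory.
Local Open Scope classical_set_scope.
Local Open Scope ring_scope.

Section AlternatingRegret.
Context {R : realType} {d : nat}.
Implicit Types (p q u x y g : 'rV[R]_d) (l : nat -> 'rV[R]_d).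

Definition dot x y : R := \sum_(i < d) x 0 i * y 0 i.

(* The library norm on matrices is the max-norm, hence these two. *)
Definition sqnorm2 x : R := \sum_(i < d) x 0 i ^+ 2.
Definition norm1 x : R := \sum_(i < d) `|x 0 i|.

Definition simplex : set 'rV[R]_d :=
  [set p | (forall i, 0 <= p 0 i) /\ \sum_(i < d) p 0 i = 1].

Definition uniform : 'rV[R]_d := const_mx d%:R^-1.

(* Some minimiser of [f] over [A]; the default value 0 is returned only when
   there is none.  Below, [f] is continuous and strictly convex and [A] is the
   simplex, so for 0 < d the minimiser exists and is unique. *)
Definition argmin (A : set 'rV[R]_d) (f : 'rV[R]_d -> R) : 'rV[R]_d :=
  xget 0 [set p | A p /\ forall q, A q -> f p <= f q].

(* Losses are indexed from 1: in round t >= 1 the algorithm plays [p t] and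
   observes [l t]; [l 0] and [p 0] are never used.  For 0 < d the supremum is a
   maximum, being that of a continuous function over the compact simplex. *)
Definition alt_regret (T : nat) (p l : nat -> 'rV[R]_d) : R :=
  sup [set \sum_(1 <= t < T.+1) dot (p t + p t.+1) (l t)
           - 2 * \sum_(1 <= t < T.+1) dot u (l t) | u in simplex].

Definition prox_step (eta : R) y g : 'rV[R]_d :=
  argmin simplex (fun p => dot p g + (2 * eta)^-1 * sqnorm2 (p - y)).

(* The pair (\hat p_{t+1}, m_{t+1}) held after [t] rounds. *)
Fixpoint oogd_state (eta : R) l (t : nat) : 'rV[R]_d * 'rV[R]_d :=
  if t is s.+1 then (prox_step eta (oogd_state eta l s).1 (l s.+1), l s.+1)
  else (uniform, 0).

Definition oogd (eta : R) l (t : nat) : 'rV[R]_d :=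
  let: (phat, m) := oogd_state eta l t.-1 in prox_step eta phat m.

Definition pos_part x : 'rV[R]_d := map_mx (Num.max 0) x.

Definition prm_play (Rt r : 'rV[R]_d) : 'rV[R]_d :=
  let Rhat := pos_part (Rt + r) in
  if Rhat == 0 then uniform else (norm1 Rhat)^-1 *: Rhat.

(* The pair (R_{t+1}, r_t) held after [t] rounds. *)
Fixpoint prm_state l (t : nat) : 'rV[R]_d * 'rV[R]_d :=
  if t is s.+1 then
    let: (Rt, r) := prm_state l s in
    let r' := const_mx (dot (prm_play Rt r) (l s.+1)) - l s.+1 in
    (pos_part (Rt + r'), r')
  else (0, 0).

Definition prm_plus l (t : nat) : 'rV[R]_d :=
  let: (Rt, r) := prm_state l t.-1 in prm_play Rt r.

End AlternatingRegret.

(* Main.v *)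
(* The losses are l_t = a_t e_1 with a_t = 4 for odd t and -1 for even t, for
   every eta and T.  Only the weight x_t that an algorithm gives to action 1
   matters, and comparing with action 2 bounds the alternating regret below by
   sum_t a_t (x_t + x_{t+1}).  Group round 2k+2 (loss -1) with round 2k+3
   (loss 4).

   OOGD: with h = eta (d-1)/d, the first coordinate y of \hat p performs a
   gradient step clipped to [0,1].  Each cycle costs at least
   2 max(y, min(1,h)), because the optimistic play moves the weight onto
   action 1 right before the loss 4.  If h >= 1/sqrt T this alone gives
   T min(1,h)/2.  Otherwise y stays above 1/(2d) for about sqrt T/(8d) cycles.

   PRM+: after round 2k+1 we have R = (0,S,..,S) and x_{2k+2} = 0, then
   x_{2k+3} = 2/(2 + (d-1)S), and S grows by 4 x_{2k+3} while the cycle costs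
   3 x_{2k+3}.  Hence the regret is about 3S/4, and S^2 increases by at least
   8/(d-1) per cycle. *)

Require Import Defs.
From HB Require Import structures.
From mathcomp Require Import all_boot all_order all_algebra.
From mathcomp Require Import boolp classical_sets reals.
From mathcomp Require Import ring lra zify.

Set Implicit Arguments.
Unset Strict Implicit.
Unset Printing Implicit Defensive.

Import Order.TTheory GRing.Theory Num.Theory.
Local Open Scope ring_scope.

Section TwoValuedVectors.
Context {R : realType} {m : nat}.
Implicit Types (p q u : 'rV[R]_m.+2) (a b x y : R).

(** * Vectors constant on actions 2 to d, where d = m + 2 and N = d - 1 *)

Local Notation N := (m.+1%:R : R).

Definition two_valued a b : 'rV[R]_m.+2 :=
  \row_j (if j == ord0 then a else b).

(** The form of every play on these losses: weight [x] on action 1, the rest shared equally. *)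
Definition sym_point x := two_valued x ((1 - x) / N).

Lemma sum_two_valued a b :
  \sum_(j < m.+2) (if j == ord0 then a else b) = a + N * b.
Proof.
rewrite big_ord_recl eqxx; congr (_ + _).
by rewrite (eq_bigr (fun=> b)) // sumr_const card_ord mulr_natl.
Qed.

Lemma dot_two_valued0 p a : dot p (two_valued a 0) = a * p 0 ord0.
Proof.
rewrite /dot (bigD1 ord0) //= big1 ?addr0 => [|i ni0].
  by rewrite mxE eqxx mulrC.
by rewrite mxE (negPf ni0) mulr0.
Qed.

Lemma simplex_sym_point x : 0 <= x <= 1 -> simplex (sym_point x).
Proof.
case/andP=> x0 x1; split=> [i|].
  by rewrite mxE; case: ifP => _ //; rewrite divr_ge0 // subr_ge0.
under eq_bigr do rewrite mxE.
by rewrite sum_two_valued mulrC divfK ?pnatr_eq0 // addrC subrK.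
Qed.

Lemma two_valued00 : two_valued 0 0 = 0.
Proof. by apply/rowP => j; rewrite !mxE; case: ifP. Qed.

Lemma two_valued_eq0 a b : (two_valued a b == 0) = (a == 0) && (b == 0).
Proof.
apply/eqP/andP => [ab0|[/eqP-> /eqP->]].
  move/rowP: ab0 => ab0; have := ab0 ord0; have := ab0 (lift ord0 ord0).
  by rewrite !mxE eqxx /= => -> ->.
exact: two_valued00.
Qed.

Lemma uniform_sym_point : uniform = sym_point (m.+2%:R)^-1.
Proof.
apply/rowP => j; rewrite !mxE; case: ifP => // _.
have N0 : N != 0 by rewrite pnatr_eq0.
have -> : m.+2%:R = 1 + N :> R by rewrite -natr1 addrC.
have N1 : 1 + N != 0 by rewrite addrC natr1 pnatr_eq0.
by move: (m.+1%:R) N0 N1 => n n0 n1; field; rewrite n0 n1.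
Qed.

(** The comparator [sym_point 0] puts no weight on action 1 and hence suffers no loss. *)
Lemma alt_regret_ge (T : nat) (p : nat -> 'rV[R]_m.+2) (a : nat -> R) :
  \sum_(1 <= t < T.+1) a t * (p t 0 ord0 + p t.+1 0 ord0)
    <= alt_regret T p (fun t => two_valued (a t) 0).
Proof.
apply: ub_le_sup; last first.
  exists (sym_point 0); first by apply: simplex_sym_point; rewrite lexx ler01.
  rewrite [X in _ - 2 * X]big1 ?mulr0 ?subr0 => [|t _]; last first.
    by rewrite dot_two_valued0 mxE eqxx mulr0.
  by apply: eq_bigr => t _; rewrite dot_two_valued0 mxE.
(* The supremum dominates its members only if the set is bounded above; a comparator gains at most
   |a_t| in round t. *)
exists (\sum_(1 <= t < T.+1) dot (p t + p t.+1) (two_valued (a t) 0)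
        + 2 * \sum_(1 <= t < T.+1) `|a t|).
move=> _ [u [u0 u1] <-]; rewrite lerD2l -mulrN ler_pM2l // -sumrN.
apply: ler_sum => t _; rewrite dot_two_valued0.
have uM : u 0 ord0 <= 1.
  by rewrite -u1 (bigD1 ord0) //= lerDl sumr_ge0.
apply: le_trans (ler_norm _) _; rewrite normrN normrM.
by rewrite (ger0_norm (u0 _)) ler_piMr.
Qed.

(** * Proximal steps as clipped gradient steps on the weight of action 1 *)

Definition clip x : R := Num.max 0 (Num.min 1 x).

Variant clip_spec x : R -> Type :=
  | ClipLow of x <= 0 : clip_spec x 0
  | ClipMid of 0 <= x <= 1 : clip_spec x x
  | ClipHigh of 1 <= x : clip_spec x 1.

Lemma clipP x : clip_spec x (clip x).
Proof.
rewrite /clip; have [x1|x1] := leP 1 x; first by rewrite max_r //; constructor.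
have [x0|x0] := leP 0 x; first by constructor; rewrite x0 ltW.
by constructor; rewrite ltW.
Qed.

Lemma clip01 x : 0 <= clip x <= 1.
Proof. by case: clipP => ?; rewrite ?lexx ?ler01. Qed.

(** Moving weight z to action 1 evenly from the others has squared length z^2 (1 + N) / N, so the
    problem is one-dimensional with the effective step eta N / (1 + N). *)
Lemma prox_step_sym_point eta x a : 0 < eta ->
  prox_step eta (sym_point x) (two_valued a 0) =
    sym_point (clip (x - eta * (N / (1 + N)) * a)).
Proof.
move=> eta0; set x' := clip _.
have N0 : 0 < N by rewrite ltr0n.
have x'01 : 0 <= x' <= 1 by exact: clip01.
set f := fun p : 'rV[R]_m.+2 =>
  dot p (two_valued a 0) + (2 * eta)^-1 * sqnorm2 (p - sym_point x).
(* Strong convexity, which also yields uniqueness of the minimiser. *)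
have key q : simplex q ->
    f (sym_point x') + (2 * eta)^-1 * sqnorm2 (q - sym_point x') <= f q.
  move=> [q0 q1]; rewrite /f !dot_two_valued0 [sym_point x' 0 _]mxE eqxx.
  have -> : sqnorm2 (q - sym_point x) = sqnorm2 (sym_point x' - sym_point x)
      + sqnorm2 (q - sym_point x')
      + 2 * ((q 0 ord0 - x') * ((x' - x) * (1 + N) / N)).
    have -> : (q 0 ord0 - x') * ((x' - x) * (1 + N) / N) =
        \sum_i (q - sym_point x') 0 i * (sym_point x' - sym_point x) 0 i.
      (* The second factor is (x - x') / N in every coordinate, up to a correction in the first; the
         constant part vanishes because both points have total weight 1. *)
      transitivity (\sum_i ((q - sym_point x') 0 i * ((x - x') / N)
         + (if i == ord0 then (q 0 ord0 - x') * ((x' - x) * (1 + N) / N)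
            else 0))).
        rewrite big_split /= -mulr_suml sum_two_valued mulr0 addr0.
        under eq_bigr do rewrite mxE [X in _ + X]mxE.
        rewrite sumrB q1; have [_ ->] := simplex_sym_point x'01.
        by rewrite subrr mul0r add0r.
      apply: eq_bigr => i _; rewrite !mxE; case: eqP => [->|_].
        by field; lra.
      by field; lra.
    rewrite /sqnorm2 mulr_sumr -!big_split; apply: eq_bigr => i _ /=.
    by rewrite !mxE; ring.
  (* First-order optimality of the clipped step. *)
  have vi : 0 <= (q 0 ord0 - x') * (a + eta^-1 * ((x' - x) * (1 + N) / N)).
    have qle1 : q 0 ord0 <= 1 by rewrite -q1 (bigD1 ord0) //= lerDl sumr_ge0.
    have -> : a + eta^-1 * ((x' - x) * (1 + N) / N) =
       (1 + N) / (N * eta) * (x' - (x - eta * (N / (1 + N)) * a)).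
      by field; lra.
    have c0 : 0 <= (1 + N) / (N * eta) by rewrite divr_ge0 ?mulr_ge0; lra.
    rewrite mulrCA; apply: mulr_ge0 => //; have := q0 ord0.
    by rewrite /x'; case: clipP => ? ?; nra.
  have -> (A B C : R) : (2 * eta)^-1 * (A + B + 2 * C) =
      (2 * eta)^-1 * A + (2 * eta)^-1 * B + eta^-1 * C by field; lra.
  move: vi; rewrite mulrDr mulrCA => vi.
  set A := _ * sqnorm2 _; set B := _ * sqnorm2 _; set C := eta^-1 * _ in vi *.
  move: A B C vi => A B C vi; lra.
have sq0 (v : 'rV[R]_m.+2) : 0 <= sqnorm2 v.
  by apply: sumr_ge0 => i _; rewrite sqr_ge0.
have eta2 : 0 < (2 * eta)^-1 by rewrite invr_gt0 mulr_gt0.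
have minx' : simplex (sym_point x') /\
    (forall q, simplex q -> f (sym_point x') <= f q).
  split=> [|q /key]; first exact: simplex_sym_point.
  by apply: le_trans; rewrite lerDl mulr_ge0 // ltW.
rewrite /prox_step /argmin; apply: xget_subset1 => //.
have uniq q : (simplex q /\ forall q', simplex q' -> f q <= f q') ->
    q = sym_point x'.
  move=> [sq qmin]; have := key _ sq; have := qmin _ minx'.1.
  move=> le1 le2; have : (2 * eta)^-1 * sqnorm2 (q - sym_point x') <= 0 by lra.
  rewrite pmulr_rle0 // => le0.
  have /eqP : sqnorm2 (q - sym_point x') = 0 by apply/le_anti; rewrite le0 sq0.
  rewrite psumr_eq0 => [/allP eq0|i _]; last exact: sqr_ge0.
  apply/rowP => i; have := eq0 i (mem_index_enum i).
  by rewrite /= sqrf_eq0 mxE [X in _ + X]mxE subr_eq0 => /eqP.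
by move=> p q /uniq-> /uniq->.
Qed.

(** * The alternating losses and their two-round cycles *)

Definition loss_coef (t : nat) : R := if odd t then 4 else -1.

Lemma loss_coef_odd k : loss_coef k.*2.+1 = 4.
Proof. by rewrite /loss_coef oddS odd_double. Qed.

Lemma loss_coef_even k : loss_coef k.*2 = -1.
Proof. by rewrite /loss_coef odd_double. Qed.

Definition alternating_loss (t : nat) : 'rV[R]_m.+2 :=
  two_valued (loss_coef t) 0.

(** Round 1 is dropped and rounds 2k+2, 2k+3 are paired. For even T the last round stays unpaired,
    which accounts for the -2. *)
Lemma sum_cycles_ge (F g : nat -> R) (T : nat) : (0 < T)%N ->
  0 <= F 1 -> (forall k, g k <= F k.*2.+2 + F k.*2.+3) ->
  (forall k, -2 <= F k.*2.+2) ->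
  \sum_(k < T.-1./2) g k - 2 <= \sum_(1 <= t < T.+1) F t.
Proof.
move=> T0 F1 cycle last.
have full K : \sum_(k < K) g k <= \sum_(1 <= t < K.*2.+2) F t.
  elim: K => [|K IH]; first by rewrite big_ord0 big_nat1.
  rewrite big_ord_recr doubleS big_nat_recr // big_nat_recr //= -addrA.
  exact: lerD (cycle K).
case: T T0 => // T _ /=; have := full T./2.
rewrite -[in X in _ -> X](odd_double_half T).
case: (odd T) => /= fullK; last by rewrite add0n half_double; lra.
rewrite add1n uphalf_double big_nat_recr //=; have := last T./2; lra.
Qed.

(** * OOGD: the weight of action 1 in \hat p_{t+1} *)

Fixpoint clipped_iterate (h : R) (t : nat) : R :=
  if t is s.+1 then clip (clipped_iterate h s - h * loss_coef s.+1)
  else (m.+2%:R)^-1.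

Section OOGD.
Context (eta : R) (eta_gt0 : 0 < eta).
Local Notation h := (eta * (N / (1 + N))).
Local Notation y := (clipped_iterate h).

Lemma oogd_state_alternating t :
  oogd_state eta alternating_loss t =
    (sym_point (y t), if t is 0 then 0 else alternating_loss t).
Proof.
elim: t => [|t IH] /=; first by rewrite uniform_sym_point.
by rewrite IH /= prox_step_sym_point.
Qed.

Lemma oogd_alternating1 : 0 <= oogd eta alternating_loss 1 0 ord0.
Proof.
rewrite /oogd oogd_state_alternating /=.
rewrite -two_valued00 prox_step_sym_point // mxE eqxx.
by case/andP: (clip01 (m.+2%:R^-1 - h * 0)).
Qed.

(** The prediction is the last loss, so the play applies that loss a second time. *)
Lemma oogd_alternatingS t :
  oogd eta alternating_loss t.+2 0 ord0 = clip (y t.+1 - h * loss_coef t.+1).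
Proof.
by rewrite /oogd oogd_state_alternating /= prox_step_sym_point // mxE eqxx.
Qed.

End OOGD.

Lemma clipped_iterate01 h t : 0 <= clipped_iterate h t <= 1.
Proof.
case: t => [|t] /=; last exact: clip01.
by rewrite invr_ge0 ler0n invf_le1 ?ltr0n // ler1n.
Qed.

Lemma clipped_iterate_even h k :
  clipped_iterate h k.*2.+2 = clip (clipped_iterate h k.*2.+1 + h).
Proof.
transitivity (clip (clipped_iterate h k.*2.+1 - h * loss_coef k.+1.*2)) => //.
by rewrite loss_coef_even mulrN1 opprK.
Qed.

Lemma clipped_iterate_odd h k :
  clipped_iterate h k.*2.+3 = clip (clipped_iterate h k.*2.+2 - 4 * h).
Proof.
transitivity
  (clip (clipped_iterate h k.*2.+2 - h * loss_coef k.+1.*2.+1)) => //.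
by rewrite loss_coef_odd [h * 4]mulrC.
Qed.

(** Round 1 and each later cycle lower the iterate by at most 4h; the gain of h in a cycle may be
    lost to clipping at 1 and is not counted. *)
Lemma clipped_iterate_odd_ge h k : 0 < h ->
  (m.+2%:R)^-1 - 4 * h * k.+1%:R <= clipped_iterate h k.*2.+1.
Proof.
move=> h0; elim: k => [|k IH].
  have /= := clipped_iterate01 h 0; rewrite (loss_coef_odd 0).
  by move: (m.+2%:R)^-1 => e ?; case: clipP => ?; lra.
move: IH (clipped_iterate01 h k.*2.+1); rewrite doubleS.
set y := clipped_iterate h k.*2.+1 => IH y01.
rewrite clipped_iterate_odd clipped_iterate_even -/y.
rewrite -[k.+2%:R]natr1; move: (m.+2%:R)^-1 (k.+1%:R) IH => e n IH.
by case: (clipP (y + h)) => ?; case: clipP => ?; lra.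
Qed.

Lemma oogd_regret_ge eta T (h := eta * (N / (1 + N))) :
  0 < eta -> (0 < T)%N ->
  \sum_(k < T.-1./2)
      2 * Num.max (clipped_iterate h k.*2.+1) (Num.min 1 h) - 2
    <= alt_regret T (oogd eta alternating_loss) alternating_loss.
Proof.
move=> eta0 T0.
have h0 : 0 < h by rewrite mulr_gt0 // divr_gt0 ?addr_gt0 ?ltr0n.
pose p t := oogd eta alternating_loss t 0 ord0.
have pE t : p t.+2 = clip (clipped_iterate h t.+1 - h * loss_coef t.+1).
  exact: oogd_alternatingS.
have p01 t : 0 <= p t.+2 <= 1 by rewrite pE clip01.
apply: le_trans (alt_regret_ge _ _ _).
pose g k := 2 * Num.max (clipped_iterate h k.*2.+1) (Num.min 1 h).
apply: (@sum_cycles_ge (fun t => loss_coef t * (p t + p t.+1)) g) => //.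
- have p1 : 0 <= p 1%N by exact: oogd_alternating1.
  rewrite (loss_coef_odd 0) mulr_ge0 // addr_ge0 //.
  by have /andP[] := p01 0%N.
- move=> k; rewrite (loss_coef_even k.+1) (loss_coef_odd k.+1) /g.
  have := p01 k.*2.+2; rewrite (pE k.*2.+1) (pE k.*2).
  rewrite (loss_coef_even k.+1) loss_coef_odd clipped_iterate_even.
  move: (clipped_iterate01 h k.*2.+1); move: (clipped_iterate _ _) => y.
  move: (p _) => p4 y01 p401; rewrite mulrN1 opprK.
  (* The cycle contributes 3 p_{2k+3} - p_{2k+2} + 4 p_{2k+4}. With M the maximum in [g], this is at
     least 3M - y, hence at least 2M. *)
  have q1 : clip (y - h * 4) <= y by case: clipP => ?; lra.
  have q2 : Num.max y (Num.min 1 h) <= clip (clip (y + h) + h).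
    rewrite ge_max ge_min.
    by case: (clipP (y + h)) => ?; case: clipP => ?; apply/andP; split;
       first [lra | apply/orP; lra].
  have q3 : y <= Num.max y (Num.min 1 h) by rewrite le_max lexx.
  lra.
- move=> k; rewrite (loss_coef_even k.+1).
  move: (p01 k.*2) (p01 k.*2.+1); move: (p _) (p _) => a b; lra.
Qed.

(** * PRM+: plays and accumulated regrets *)

Lemma prm_play_two_valued (u v r s : R) : 0 < v + s ->
  prm_play (two_valued u v) (two_valued r s) =
    sym_point (Num.max 0 (u + r) / (Num.max 0 (u + r) + N * (v + s))).
Proof.
move=> vs; rewrite /prm_play.
have -> : pos_part (two_valued u v + two_valued r s) =
    two_valued (Num.max 0 (u + r)) (v + s).
  apply/rowP => j; rewrite !mxE; case: eqP => // _.
  by rewrite max_r // ltW.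
have N0 : 0 < N by rewrite ltr0n.
have a0 : 0 <= Num.max 0 (u + r) by rewrite le_max lexx.
rewrite two_valued_eq0 (gt_eqF vs) andbF.
move: (Num.max 0 _) (v + s) a0 vs => a b a0 b0.
have Nb : 0 < N * b by rewrite mulr_gt0.
have -> : norm1 (two_valued a b) = a + N * b.
  rewrite /norm1 -sum_two_valued; apply: eq_bigr => j _; rewrite mxE.
  by case: ifP => _; rewrite ger0_norm // ltW.
apply/rowP => j; rewrite !mxE; case: ifP => _; first by rewrite mulrC.
by move: N N0 Nb => n n0 nb; field; lra.
Qed.

Lemma prm_state_step t (u v x : R) r :
  prm_state alternating_loss t = (two_valued u v, r) ->
  prm_play (two_valued u v) r = sym_point x ->
  let a := loss_coef t.+1 in
  prm_state alternating_loss t.+1 =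
    (two_valued (Num.max 0 (u + (a * x - a))) (Num.max 0 (v + a * x)),
     two_valued (a * x - a) (a * x)).
Proof.
move=> /= -> ->; rewrite dot_two_valued0 mxE eqxx.
have -> : const_mx (loss_coef t.+1 * x) - alternating_loss t.+1 =
    two_valued (loss_coef t.+1 * x - loss_coef t.+1) (loss_coef t.+1 * x).
  by apply/rowP => j; rewrite !mxE; case: ifP => //; rewrite subr0.
by congr (_, _); apply/rowP => j; rewrite !mxE; case: ifP.
Qed.

(** The entry S shared by actions 2 to d of R after round 2k+1. Its start 4/d comes from the uniform
    play against the first loss. *)
Fixpoint prm_mass (k : nat) : R :=
  if k is j.+1 then prm_mass j + 8 / (2 + N * prm_mass j)
  else 4 / (1 + N).

Lemma prm_mass_gt0 k : 0 < prm_mass k.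
Proof.
have N0 : 0 < N by rewrite ltr0n.
elim: k => [|k IH] /=; first by rewrite divr_gt0 ?addr_gt0.
by rewrite addr_gt0 // divr_gt0 // addr_gt0 // mulr_gt0.
Qed.

Lemma mul_prm_mass_ge2 k : 2 <= N * prm_mass k.
Proof.
have N1 : 1 <= N by rewrite ler1n.
elim: k => [|k IH] /=.
  by rewrite mulrA ler_pdivlMr; lra.
apply: le_trans IH _; rewrite ler_pM2l; last lra.
rewrite lerDl divr_ge0 //.
by rewrite addr_ge0 // mulr_ge0 ?ltW ?prm_mass_gt0.
Qed.

(** When S + 8 / (2 + N S) is squared and multiplied by N, the cross term is 16 N S / (2 + N S),
    which is at least 8 because N S >= 2. *)
Lemma prm_mass_sq k : 8 * k%:R <= N * prm_mass k ^+ 2.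
Proof.
elim: k => [|k IH].
  by rewrite mulr0 mulr_ge0 // sqr_ge0.
have := mul_prm_mass_ge2 k; have := prm_mass_gt0 k => /=.
move: (prm_mass k) IH; have : 0 < N by rewrite ltr0n.
move: N => n n0 s IH s0 ns.
rewrite -[k.+1%:R]natr1 mulrDr mulr1 sqrrD.
have : 4 <= n * (s * (8 / (2 + n * s))).
  rewrite mulrA [8 / _]mulrC mulrA mulrAC ler_pdivlMr; nra.
have : 0 <= n * (8 / (2 + n * s)) ^+ 2 by rewrite mulr_ge0 ?sqr_ge0 ?ltW.
rewrite !mulrDr -mulr_natr; lra.
Qed.

Definition prm_weight k : R := 2 / (2 + N * prm_mass k).

Lemma prm_weight_bounds k : 0 <= prm_weight k <= 1 / 2.
Proof.
have := mul_prm_mass_ge2 k; rewrite /prm_weight => s2.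
by rewrite divr_ge0 ?ler_pdivrMr; lra.
Qed.

(** Telescoping: each cycle raises S by four times the weight played. *)
Lemma sum_prm_weight K :
  \sum_(k < K) 4 * prm_weight k = prm_mass K - prm_mass 0.
Proof.
elim: K => [|K IH]; first by rewrite big_ord0 subrr.
by rewrite big_ord_recr IH /= /prm_weight; lra.
Qed.

(** In round 2k+2 the prediction -b keeps action 1 at weight 0, so R becomes (1,S,..,S) and r =
    (1,0,..,0). Together they give 2 against S in round 2k+3, after which the loss 4 resets the
    first entry. Only the signs of [b] and [c] matter, so the first cycle is covered too. *)
Lemma prm_cycle k b c : 0 <= b -> 0 <= c ->
  prm_state alternating_loss k.*2.+1 =
    (two_valued 0 (prm_mass k), two_valued (- b) c) ->
  [/\ prm_plus alternating_loss k.*2.+2 = sym_point 0,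
      prm_plus alternating_loss k.*2.+3 = sym_point (prm_weight k) &
      prm_state alternating_loss k.*2.+3 =
        (two_valued 0 (prm_mass k.+1),
         two_valued (- (4 * (1 - prm_weight k))) (4 * prm_weight k))].
Proof.
move=> b0 c0 st; have s0 := prm_mass_gt0 k.
have /andP[w0 w1] := prm_weight_bounds k.
have play0 : prm_play (two_valued 0 (prm_mass k)) (two_valued (- b) c) =
    sym_point 0.
  rewrite prm_play_two_valued ?ltr_wpDr // add0r max_l ?mul0r //; lra.
have st2 : prm_state alternating_loss k.*2.+2 =
    (two_valued 1 (prm_mass k), two_valued 1 0).
  rewrite (prm_state_step st play0) (loss_coef_even k.+1) !mulr0.
  by rewrite add0r opprK add0r addr0 !max_r // ltW.
have play1 : prm_play (two_valued 1 (prm_mass k)) (two_valued 1 0) =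
    sym_point (prm_weight k).
  by rewrite prm_play_two_valued ?addr0 // max_r // addr_ge0.
split=> //.
- by rewrite /prm_plus [_.-1]/= st.
- by rewrite /prm_plus [_.-1]/= st2.
rewrite (prm_state_step st2 play1) (loss_coef_odd k.+1).
(* The first entry 1 + 4w - 4 is negative since the weight w is at most 1/2. *)
rewrite max_l; last lra.
rewrite max_r; last lra.
by congr (two_valued _ _, two_valued _ _); rewrite /= /prm_weight; lra.
Qed.

Lemma prm_state_odd k : exists b c, [/\ 0 <= b, 0 <= c &
  prm_state alternating_loss k.*2.+1 =
    (two_valued 0 (prm_mass k), two_valued (- b) c)].
Proof.
elim: k => [|k [b [c [b0 c0 st]]]]; last first.
  have [_ _ st'] := prm_cycle b0 c0 st.
  have /andP[w0 w1] := prm_weight_bounds k.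
  exists (4 * (1 - prm_weight k)), (4 * prm_weight k).
  by split; [lra | lra | rewrite doubleS].
(* In round 1 the vector \hat R is zero, so the uniform default is played. *)
have play : prm_play (two_valued 0 0) (two_valued 0 0) =
    sym_point (m.+2%:R)^-1 :> 'rV[R]_m.+2.
  rewrite /prm_play two_valued00 addr0.
  have -> : pos_part 0 = 0 :> 'rV[R]_m.+2.
    by apply/rowP => j; rewrite !mxE maxxx.
  by rewrite eqxx uniform_sym_point.
have st0 : prm_state alternating_loss 0 = (two_valued 0 0, two_valued 0 0).
  by rewrite two_valued00.
have mass0 : prm_mass 0 = 4 * (m.+2%:R)^-1 by rewrite /= -natr1 addrC.
have i0 : 0 <= (m.+2%:R)^-1 :> R by rewrite invr_ge0 ler0n.
have i1 : (m.+2%:R)^-1 <= 1 :> R by rewrite invf_le1 ?ltr0n // ler1n.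
move: (m.+2%:R)^-1 play mass0 i0 i1 => e play mass0 e0 e1.
exists (4 - 4 * e), (4 * e); split; [lra | lra |].
rewrite (prm_state_step st0 play) (loss_coef_odd 0) !add0r.
by rewrite max_l ?max_r ?mass0 ?opprB //; lra.
Qed.

Lemma prm_plus_even k :
  prm_plus alternating_loss k.*2.+2 0 ord0 = 0.
Proof.
have [b [c [b0 c0 st]]] := prm_state_odd k.
by have [-> _ _] := prm_cycle b0 c0 st; rewrite mxE.
Qed.

Lemma prm_plus_odd k :
  prm_plus alternating_loss k.*2.+3 0 ord0 = prm_weight k.
Proof.
have [b [c [b0 c0 st]]] := prm_state_odd k.
by have [_ -> _] := prm_cycle b0 c0 st; rewrite mxE.
Qed.

Lemma prm_plus_alternating1 : 0 <= prm_plus alternating_loss 1 0 ord0.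
Proof.
rewrite /prm_plus /= /prm_play.
have -> : pos_part (0 + 0) = 0 :> 'rV[R]_m.+2.
  by apply/rowP => j; rewrite !mxE addr0 maxxx.
by rewrite eqxx mxE invr_ge0 ler0n.
Qed.

(** The weights 0, w, 0 in rounds 2k+2 to 2k+4 give the cycle the value -w + 4w = 3w. *)
Lemma prm_plus_regret_ge T : (0 < T)%N ->
  \sum_(k < T.-1./2) 3 * prm_weight k - 2
    <= alt_regret T (prm_plus alternating_loss) alternating_loss.
Proof.
move=> T0; apply: le_trans (alt_regret_ge _ _ _).
pose p t := prm_plus alternating_loss t 0 ord0.
have p_even k : p k.*2.+2 = 0 by exact: prm_plus_even.
have p_odd k : p k.*2.+3 = prm_weight k by exact: prm_plus_odd.
apply: (@sum_cycles_ge (fun t => loss_coef t * (p t + p t.+1))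
          (fun k => 3 * prm_weight k)) => //.
- have p1 : 0 <= p 1%N by exact: prm_plus_alternating1.
  have := p_even 0%N; rewrite (loss_coef_odd 0) => ->; lra.
- move=> k; rewrite (loss_coef_even k.+1) (loss_coef_odd k.+1).
  have := p_even k.+1; rewrite doubleS => ->; rewrite p_even p_odd; lra.
- move=> k; rewrite (loss_coef_even k.+1) p_even p_odd.
  have /andP[] := prm_weight_bounds k; lra.
Qed.

(** * Growth of both sums, with s for sqrt T and K for the number of cycles *)

Lemma sum_clipped_iterate_ge h (s : R) K : 0 < h ->
  48 * m.+2%:R ^+ 2 <= s -> s ^+ 2 <= 4 * K%:R ->
  (16 * m.+2%:R ^+ 2)^-1 * s <=
    \sum_(k < K) 2 * Num.max (clipped_iterate h k.*2.+1) (Num.min 1 h) - 2.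
Proof.
move=> h0; have D2 : 2 <= m.+2%:R :> R by rewrite ler_nat.
have D0 : 0 < m.+2%:R :> R by rewrite ltr0n.
have DV0 : m.+2%:R != 0 :> R by rewrite pnatr_eq0.
set g := fun k : nat => 2 * Num.max (clipped_iterate h k.*2.+1) (Num.min 1 h).
rewrite -[X in _ <= X - 2]/(\sum_(k < K) g k).
set t := m.+2%:R ^-2 * s => D48 sK.
have -> : (16 * m.+2%:R ^+ 2)^-1 * s = t / 16 by rewrite invfM -mulrA mulrC.
have t48 : 48 <= t by rewrite /t mulrC ler_pdivlMr // exprn_gt0.
have st : s = t * m.+2%:R ^+ 2 by rewrite /t mulrAC mulVf ?mul1r // expf_neq0.
have s4t : 4 * t <= s by rewrite st mulrC ler_pM2l; nra.
have [s0 s1] : 0 < s /\ 1 <= s by lra.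
clearbody t.
(* For h >= 1/s each term is at least 2/s, and K >= s^2/4 terms give s/2. *)
have [hs|hs] := leP s^-1 h.
  have : \sum_(k < K) 2 * s^-1 <= \sum_(k < K) g k.
    apply: ler_sum => k _; rewrite ler_pM2l // le_max; apply/orP; right.
    by rewrite le_min hs andbT invf_le1.
  rewrite sumr_const card_ord -[_ *+ K]mulr_natl.
  have : s / 2 <= K%:R * (2 * s^-1).
    by rewrite mulrA ler_pdivlMr // mulrAC -expr2; lra.
  move: (_ * (2 * _)) (\sum_(k < K) g k) => a b; lra.
(* For k < M and h < 1/s the total drop 4h(k+1) is at most 4M/s <= 1/(2d), so the iterate keeps at
   least half of its initial value 1/d. *)
pose M := Num.truncn (s / (8 * m.+2%:R)).
have /andP[Mle ltM] : M%:R <= s / (8 * m.+2%:R) < M.+1%:R.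
  by rewrite truncn_itv // divr_ge0 ?mulr_ge0 // ltW.
have MK : (M <= K)%N.
  rewrite -(ler_nat R); apply: le_trans Mle _.
  rewrite ler_pdivrMr ?mulr_gt0 //; nra.
have gM k : (k < M)%N -> (m.+2%:R)^-1 <= g k.
  move=> kM; have := clipped_iterate_odd_ge k h0.
  have : clipped_iterate h k.*2.+1 <=
      Num.max (clipped_iterate h k.*2.+1) (Num.min 1 h).
    by rewrite le_max lexx.
  have : h * k.+1%:R <= (8 * m.+2%:R)^-1.
    apply: (@le_trans _ _ (s^-1 * (s / (8 * m.+2%:R)))).
      apply: ler_pM => //; [exact: ltW|exact: ltW|].
      by apply: le_trans Mle; rewrite ler_nat.
    by rewrite mulrA mulVf ?mul1r // gt_eqF.
  rewrite invfM /g -[4 * h * _]mulrA; move: (h * _) (m.+2%:R)^-1 => a e.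
  move: (Num.max _ _) => x; move: (clipped_iterate _ _) => y; lra.
have g0 k : 0 <= g k.
  rewrite mulr_ge0 // le_max; have /andP[-> //] := clipped_iterate01 h k.*2.+1.
have : M%:R * (m.+2%:R)^-1 <= \sum_(k < K) g k.
  rewrite -(big_mkord xpredT) (big_cat_nat _ MK) //= ler_wpDr ?sumr_ge0 //.
  rewrite mulr_natl -[M in X in X <= _]card_ord -sumr_const big_mkord.
  by apply: ler_sum => k _; exact: gM.
have : (s / (8 * m.+2%:R) - 1) * (m.+2%:R)^-1 <= M%:R * (m.+2%:R)^-1.
  by rewrite ler_pM2r ?invr_gt0 // lerBlDr natr1 ltW.
have -> : (s / (8 * m.+2%:R) - 1) * (m.+2%:R)^-1 = t / 8 - (m.+2%:R)^-1.
  by rewrite st; move: (m.+2%:R) DV0 => n n0; field.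
have : (m.+2%:R)^-1 <= 1 :> R by rewrite invf_le1 //; lra.
(* Here t/8 - 1/d - 2 >= t/16 follows from t >= 48 and 1/d <= 1; this is the source of the constant
   48. *)
move: (M%:R * _) => a; move: (m.+2%:R)^-1 (\sum_(k < K) g k) => e b; lra.
Qed.

Lemma sum_prm_weight_ge (s : R) K :
  48 * m.+2%:R ^+ 2 <= s -> s ^+ 2 <= 4 * K%:R ->
  (16 * m.+2%:R ^+ 2)^-1 * s <= \sum_(k < K) 3 * prm_weight k - 2.
Proof.
have D2 : 2 <= m.+2%:R :> R by rewrite ler_nat.
have DN : m.+2%:R = 1 + N :> R by rewrite -natr1 addrC.
have N0 : 0 < N by rewrite ltr0n.
have D0 : 0 < m.+2%:R :> R by lra.
set t := m.+2%:R ^-2 * s => D48 sK.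
have -> : (16 * m.+2%:R ^+ 2)^-1 * s = t / 16 by rewrite invfM -mulrA mulrC.
have t48 : 48 <= t by rewrite /t mulrC ler_pdivlMr // exprn_gt0.
have -> : \sum_(k < K) 3 * prm_weight k = 3 / 4 * (prm_mass K - prm_mass 0).
  rewrite -sum_prm_weight mulr_sumr; apply: eq_bigr => k _; lra.
have mass0 : prm_mass 0 <= 2 by rewrite /= ler_pdivrMr; lra.
have massK : 2 * t <= prm_mass K.
  have m0 := prm_mass_gt0 K; have := prm_mass_sq K => mK.
  rewrite -(ler_pXn2r (ltn0Sn 1)) ?nnegrE ?(ltW m0) //; last lra.
  have st : s = t * m.+2%:R ^+ 2.
    by rewrite /t mulrAC mulVf ?mul1r // expf_neq0 // gt_eqF.
  (* The middle term is 2 s^2 = 2 t^2 (1 + N)^4: it is at most 8K and dominates 4 t^2 N. *)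
  have : (2 * t) ^+ 2 * N <= N * prm_mass K ^+ 2.
    apply: le_trans mK; apply: (@le_trans _ _ (2 * s ^+ 2)); last lra.
    rewrite st DN; move: N N0 t t48 {st} => n n0 t' _; nra.
  by rewrite mulrC ler_pM2l.
lra.
Qed.

End TwoValuedVectors.

Theorem theorem19 (R : realType) (d : nat) (hd : (2 <= d)%N) :
  exists2 c : R, 0 < c &
  exists T0 : nat, forall T : nat, (T0 <= T)%N ->
  forall eta : R, 0 < eta ->
  exists l : nat -> 'rV[R]_d,
    [/\ forall (t : nat) (i : 'I_d), (1 <= t <= T)%N -> -4 <= l t 0 i <= 4,
        c * Num.sqrt T%:R <= alt_regret T (oogd eta l) l &
        c * Num.sqrt T%:R <= alt_regret T (prm_plus l) l].
Proof.
case: d hd => [//|[//|m]] _.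
exists (16 * m.+2%:R ^+ 2)^-1; first by rewrite invr_gt0 mulr_gt0 // exprn_gt0.
(* This threshold says exactly that sqrt T >= 48 d^2. *)
exists ((48 * m.+2 ^ 2) ^ 2)%N => T TT eta eta0; exists alternating_loss.
have T4 : (4 <= T)%N.
  by apply: leq_trans TT; rewrite -[4%N]/(2 ^ 2)%N leq_exp2r //; nia.
have sD : 48 * m.+2%:R ^+ 2 <= Num.sqrt T%:R :> R.
  rewrite -(ler_pXn2r (ltn0Sn 1)) ?nnegrE ?sqrtr_ge0 ?mulr_ge0 ?exprn_ge0 //.
  by rewrite sqr_sqrtr // -natrX -natrM -natrX ler_nat.
(* From T >= 4 it follows that the floor of (T - 1)/2 is at least T/4. *)
have sK : Num.sqrt T%:R ^+ 2 <= 4 * (T.-1./2)%:R :> R.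
  rewrite sqr_sqrtr // -natrM ler_nat; lia.
have T0 : (0 < T)%N by lia.
split=> [t i _||].
- rewrite mxE /loss_coef; case: ifP => _; last lra.
  by case: ifP => _; lra.
- apply: le_trans (oogd_regret_ge eta0 T0).
  by apply: sum_clipped_iterate_ge; rewrite // mulr_gt0 // divr_gt0 ?addr_gt0.
- by apply: le_trans (prm_plus_regret_ge T0); exact: sum_prm_weight_ge.
Qed.
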